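(* For every $0\leq r\leq (\log \log n)^{O(1)}$, any $r$-round two-sided testing algorithm for $(1,3,2)$-freeness of sequences $f\colon[n]\to\mathbb{R}$ must make $\Omega\!\left(n^{1/2^{r+3}}\right)$ queries.
   Context: A sequence $f\colon[n]\to\mathbb{R}$ contains the pattern $(1,3,2)$ if there are $i<j<l$ with $f(i)<f(l)<f(j)$; otherwise it is $(1,3,2)$-free. $f$ is $\varepsilon$-far from $(1,3,2)$-freeness if more than $\varepsilon n$ values must be changed to make it $(1,3,2)$-free. A (two-sided) $\varepsilon$-test accepts $(1,3,2)$-free inputs with probability at least $2/3$ and rejects $\varepsilon$-far inputs with probability at least $2/3$; here the proximity parameter $\varepsilon$ is a fixed constant. An $r$-round test proceeds in $r$ stages: in each stage it chooses a batch of queries that may depend only on answers from previous stages, then receives all answers; after the $r$ stages it outputs its decision. Query complexity is the total number of queries. *)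

(* Defs.v *)
From HB Require Import structures.
From mathcomp Require Import all_boot all_order all_algebra.
From mathcomp Require Import all_classical all_reals all_analysis.

Set Implicit Arguments.
Unset Strict Implicit.
Unset Printing Implicit Defensive.

Import Order.TTheory GRing.Theory Num.Theory.
Local Open Scope ring_scope.
Local Open Scope classical_set_scope.

Definition contains_132 (R : realType) (n : nat) (f : {ffun 'I_n -> R}) : Prop :=
  exists i j l : 'I_n, [/\ (i < j)%N, (j < l)%N, f i < f l & f l < f j].

Definition free_132 (R : realType) (n : nat) (f : {ffun 'I_n -> R}) : Prop :=
  ~ contains_132 f.

Definition far_from_132_free (R : realType) (n : nat) (eps : R)
    (f : {ffun 'I_n -> R}) : Prop :=
  forall g : {ffun 'I_n -> R}, free_132 g ->
    eps * n%:R < #|[set i | f i != g i]%SET|%:R.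

(* The answers to the batch Q: they carry no information on f outside Q. *)
Definition answers (R : realType) (n : nat) (Q : {set 'I_n})
    (f : {ffun 'I_n -> R}) : {ffun 'I_n -> option R} :=
  [ffun i => if i \in Q then Some (f i) else None].

(* A deterministic r-round algorithm, as a decision tree of depth r: the batch
   of a stage is determined by its position in the tree, hence only by the
   answers received in the previous stages. *)
Inductive round_algo (R : realType) (n : nat) : nat -> Type :=
| Decide (accept : bool) : round_algo R n 0
| Stage (r : nat) (Q : {set 'I_n})
    (next : {ffun 'I_n -> option R} -> round_algo R n r) : round_algo R n r.+1.

Fixpoint accepts (R : realType) (n r : nat) (A : round_algo R n r)
    (f : {ffun 'I_n -> R}) : bool :=
  match A with
  | Decide b => b
  | Stage _ Q next => accepts (next (answers Q f)) f
  end.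

Fixpoint num_queries (R : realType) (n r : nat) (A : round_algo R n r)
    (f : {ffun 'I_n -> R}) : nat :=
  match A with
  | Decide _ => 0%N
  | Stage _ Q next => (#|Q| + num_queries (next (answers Q f)) f)%N
  end.

(* A randomized algorithm is a deterministic one chosen by a random seed w in
   an arbitrary probability space (T, P); acceptance must be an event. *)
Record is_two_sided_test (R : realType) (n r : nat) (eps : R)
    (d : measure_display) (T : measurableType d) (P : probability T R)
    (A : T -> round_algo R n r) : Prop := IsTwoSidedTest {
  test_event : forall f : {ffun 'I_n -> R},
    measurable [set w | accepts (A w) f] ;
  test_complete : forall f : {ffun 'I_n -> R}, free_132 f ->
    ((2 / 3)%:E <= P [set w | accepts (A w) f])%E ;
  test_sound : forall f : {ffun 'I_n -> R}, far_from_132_free eps f ->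
    ((2 / 3)%:E <= P [set w | ~~ accepts (A w) f])%E
}.

Definition makes_at_most (R : realType) (n r : nat) (T : Type)
    (A : T -> round_algo R n r) (q : nat) : Prop :=
  forall (w : T) (f : {ffun 'I_n -> R}), (num_queries (A w) f <= q)%N.

(* Main.v *)
Require Import Defs.
From HB Require Import structures.
From mathcomp Require Import all_boot all_order all_algebra.
From mathcomp Require Import all_classical all_reals all_analysis.
From mathcomp Require Import measurable_realfun zify lra.

(* Idea. Hide a monotone matching between a decreasing list of increasing pairs
   ("left") and an increasing list of single values ("right"): the input contains
   a 132 pattern exactly when some right value lies strictly between the two values
   of its matched pair, and one private coin per pair decides which, so an algorithm
   learns nothing unless it queries both sides of one matched pair. The two lists
   are the leaves of two K-ary trees of depth r, and every node shifts the labels of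
   its children by an independent uniform amount in [0, D]; leaves with equal
   labels are matched. By induction, after j rounds no two matched nodes of depth j
   have both been queried, except with probability j q^2 / (D + 1): one of two
   matched nodes is untouched, its shift is independent of the transcript, and each
   of the q^2 pairs of queries needs one specific value of it. With D = 3 r q^2 and
   K about (n / 3)^(1 / r) >= 6 r^2 q^2 a constant fraction of the leaves stays
   matched, and the failure probability is below 1/3. *)

Set Implicit Arguments.
Unset Strict Implicit.
Unset Printing Implicit Defensive.

Import Order.TTheory GRing.Theory Num.Theory.
Local Open Scope ring_scope.

(** * Transcripts of adaptive runs *)

Fixpoint queried (R : realType) (n r : nat) (A : round_algo R n r)
    (f : {ffun 'I_n -> R}) (j : nat) : {set 'I_n} :=
  match A, j with
  | Stage _ Q next, j'.+1 => Q :|: queried (next (answers Q f)) f j'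
  | _, _ => finset.set0
  end.

Section Runs.
Variables (R : realType) (n : nat).
Implicit Types f g : {ffun 'I_n -> R}.

Lemma eq_answers (Q : {set 'I_n}) f g : {in Q, f =1 g} -> answers Q f = answers Q g.
Proof. by move=> fg; apply/ffunP => i; rewrite !ffunE; case: ifP => // /fg ->. Qed.

Lemma queried0 r (A : round_algo R n r) f : queried A f 0 = finset.set0.
Proof. by case: A. Qed.

Lemma eq_queried r (A : round_algo R n r) f g j :
  {in queried A f j, f =1 g} -> queried A f j = queried A g j.
Proof.
elim: A j => [b|r' Q next IH] [|j] //= fg.
have fgQ : {in Q, f =1 g} by move=> i iQ; apply: fg; rewrite inE iQ.
rewrite -(eq_answers fgQ); congr (_ :|: _); apply: IH => i ij.
by apply: fg; rewrite inE ij orbT.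
Qed.

(** Bounded adaptivity enters here: the batch of round [j.+1] is fixed by the answers of the first
    [j] rounds. *)
Lemma eq_queriedS r (A : round_algo R n r) f g j :
  {in queried A f j, f =1 g} -> queried A f j.+1 = queried A g j.+1.
Proof.
elim: A j => [b|r' Q next IH] [|j] //= fg; first by rewrite !queried0.
have fgQ : {in Q, f =1 g} by move=> i iQ; apply: fg; rewrite inE iQ.
rewrite -(eq_answers fgQ); congr (_ :|: _); apply: IH => i ij.
by apply: fg; rewrite inE ij orbT.
Qed.

Lemma eq_accepts r (A : round_algo R n r) f g :
  {in queried A f r, f =1 g} -> accepts A f = accepts A g.
Proof.
elim: A => [b|r' Q next IH] //= fg.
have fgQ : {in Q, f =1 g} by move=> i iQ; apply: fg; rewrite inE iQ.
rewrite -(eq_answers fgQ); apply: IH => i ij.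
by apply: fg; rewrite inE ij orbT.
Qed.

Lemma card_queried r (A : round_algo R n r) f j :
  (#|queried A f j| <= num_queries A f)%N.
Proof.
elim: A j => [b|r' Q next IH] [|j] //=; rewrite ?cards0 //.
by rewrite (leq_trans (leq_card_setU _ _)) // leq_add2l.
Qed.

End Runs.

(** Overwriting coordinate [v] maps pairs of a point of [E && G] and a new value into [E]. The map
    is injective because under [G] the other coordinates determine the old value. *)
Lemma card_update_unique (T : finType) (D : nat)
    (E G : pred {ffun T -> 'I_D.+1}) (v : T) :
  (forall s s' : {ffun T -> 'I_D.+1},
     (forall t, t != v -> s t = s' t) -> E s -> E s') ->
  (forall s s' : {ffun T -> 'I_D.+1},
     (forall t, t != v -> s t = s' t) -> G s -> G s' -> s v = s' v) ->
  (D.+1 * #|[set s | E s && G s]%SET| <= #|[set s | E s]%SET|)%N.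
Proof.
move=> hE hG.
pose upd (p : {ffun T -> 'I_D.+1} * 'I_D.+1) : {ffun T -> 'I_D.+1} :=
  [ffun t => if t == v then p.2 else p.1 t].
have -> : (D.+1 * #|[set s | E s && G s]%SET|)%N =
    #|finset.setX [set s | E s && G s]%SET [set: 'I_D.+1]%SET|.
  by rewrite cardsX cardsT card_ord mulnC.
have inj : {in finset.setX [set s | E s && G s]%SET [set: 'I_D.+1]%SET &, injective upd}.
  move=> [s x] [s' x'] /=; rewrite !inE /= !andbT.
  move=> /andP[Es Gs] /andP[Es' Gs'] /ffunP eq_upd.
  have offv t : t != v -> s t = s' t.
    by move=> /negPf tv; have := eq_upd t; rewrite !ffunE tv.
  have -> : x = x' by have := eq_upd v; rewrite !ffunE eqxx.
  congr (_, _); apply/ffunP => t; have [->|/offv //] := eqVneq t v.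
  exact: hG.
rewrite -(card_in_imset inj); apply: subset_leq_card; apply/fintype.subsetP => s'.
move=> /imsetP[[s x]]; rewrite !inE /= andbT => /andP[Es _] ->.
by apply: hE Es => t /negPf tv; rewrite ffunE tv.
Qed.

(** * Shifted digit labels of tree nodes *)

Local Open Scope nat_scope.

(* Shifts the base-[K] digits of the depth-[j] node [p] by [s] along its path from
   the root and reads the result in base [W]. *)
Fixpoint lab (K W : nat) (s : nat -> nat -> nat) (j p : nat) : nat :=
  if j is j'.+1 then lab K W s j' (p %/ K) * W + (p %% K + s j' (p %/ K)) else 0.

(** Shifted digits stay below [W], so nothing carries, and siblings share one shift, so it preserves
    their order. *)
Lemma ltn_lab (K W : nat) (s : nat -> nat -> nat) (j p p' : nat) :
  0 < K -> (forall j p d, d < K -> d + s j p < W) ->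
  p' < K ^ j -> p < p' -> lab K W s j p < lab K W s j p'.
Proof.
move=> K0 hW; elim: j p p' => [|j IH] p p'; first by rewrite expn0; lia.
rewrite expnSr => p'K pp' /=.
have hp := hW j (p %/ K) _ (ltn_pmod p K0).
have [lt|ge] := ltnP (p %/ K) (p' %/ K).
  have := IH _ _ _ lt; rewrite ltn_divLR // => /(_ p'K) lt'.
  have := leq_mul lt' (leqnn W); rewrite mulSn; lia.
have eqd : p %/ K = p' %/ K.
  by apply/eqP; rewrite eqn_leq ge andbT; apply: leq_div2r; exact: ltnW.
rewrite eqd ltn_add2l ltn_add2r.
have := divn_eq p K; have := divn_eq p' K; rewrite eqd; lia.
Qed.

Lemma lab_lt (K W : nat) (s : nat -> nat -> nat) (j p : nat) :
  0 < K -> (forall j p d, d < K -> d + s j p < W) -> lab K W s j p < W ^ j.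
Proof.
move=> K0 hW; elim: j p => [|j IH] p //=; rewrite expnSr.
have := leq_mul (IH (p %/ K)) (leqnn W); rewrite mulSn.
have := hW j (p %/ K) _ (ltn_pmod p K0); lia.
Qed.

Lemma lab_divn (K W : nat) (s : nat -> nat -> nat) (j p : nat) :
  0 < K -> (forall j p d, d < K -> d + s j p < W) ->
  lab K W s j.+1 p %/ W = lab K W s j (p %/ K).
Proof.
move=> K0 hW; have h := hW j (p %/ K) _ (ltn_pmod p K0).
rewrite /= divnMDl; last by lia.
by rewrite (divn_small h) addn0.
Qed.

(** [p %/ K ^ (j - i)] is the depth-[i] ancestor of [p]; the shift of [p] itself acts only on its
    children. *)
Lemma eq_lab (K W : nat) (s s' : nat -> nat -> nat) (j p : nat) :
  (forall i, i < j -> s i (p %/ K ^ (j - i)) = s' i (p %/ K ^ (j - i))) ->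
  lab K W s j p = lab K W s' j p.
Proof.
elim: j p => [|j IH] p //= h; rewrite (IH (p %/ K)); last first.
  by move=> i ij; rewrite -divnMA -expnS -subSn ?h // ltnW // ltnS.
by have := h j (ltnSn j); rewrite subSnn expn1 => ->.
Qed.

Lemma divnX_step (K r j a : nat) : j < r ->
  a %/ K ^ (r - j.+1) %/ K = a %/ K ^ (r - j).
Proof. by move=> jr; rewrite -divnMA -expnSr -subSn // subSS. Qed.

(* The label has all its digits in [D, K), which every shift of at most D reaches. *)
Lemma lab_onto (K D : nat) (s : nat -> nat -> nat) (j u : nat) :
  D < K -> (forall j p, s j p <= D) -> u < (K - D) ^ j ->
  exists2 p, p < K ^ j & lab K (K + D) s j p = lab (K - D) (K + D) (fun _ _ => D) j u.
Proof.
move=> DK hs; elim: j u => [|j IH] u; first by exists 0.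
rewrite expnSr -ltn_divLR; last by lia.
move=> /IH[p pK Ep] /=.
have hu : u %% (K - D) < K - D by rewrite ltn_mod; lia.
pose d := u %% (K - D) + D - s j p.
have sD := hs j p.
have dK : d < K by rewrite /d; lia.
have K0 : 0 < K by lia.
exists (p * K + d).
  by rewrite expnSr; have := leq_mul pK (leqnn K); rewrite mulSn; lia.
rewrite divnMDl // (divn_small dK) addn0 Ep modnMDl (modn_small dK).
by congr (_ + _); rewrite /d; lia.
Qed.

(** Bernoulli's inequality for [(1 - D / K) ^ r.+1], cleared of denominators. *)
Lemma bernoulli_expn (K D r : nat) :
  D <= K -> K ^ r.+1 <= (K - D) ^ r.+1 + r.+1 * (D * K ^ r).
Proof.
move=> DK; elim: r => [|r IH]; first by rewrite !expn1 expn0; lia.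
rewrite [K ^ r.+2]expnS [(K - D) ^ _]expnS.
have le1 : K ^ r.+1 >= (K - D) ^ r.+1 by rewrite leq_exp2r // leq_subr.
have eqK : K ^ r.+1 = K * K ^ r by rewrite expnS.
move: (K ^ r) (K ^ r.+1) ((K-D) ^ r.+1) IH le1 eqK => a b c IH le1 eqK.
have {IH}: K * b <= K * (c + r.+1 * (D * a)) by rewrite leq_mul2l IH orbT.
have eqc : K * c = (K - D) * c + D * c by rewrite -mulnDl subnK.
have : D * c <= D * b by rewrite leq_mul2l le1 orbT.
nia.
Qed.

Lemma expn_half_sub (K D r : nat) :
  2 * (r * D) <= K -> K ^ r <= 2 * (K - D) ^ r.
Proof.
case: r => [|r] h; first by rewrite !expn0.
have DK : D <= K by nia.
have := bernoulli_expn r DK.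
have := leq_mul h (leqnn (K ^ r)); rewrite -expnS.
nia.
Qed.

(* [(b, j, p)] is the depth-[j] node with index [p < K ^ j] of the right ([b = true])
   or left tree. *)
Definition node (K r : nat) : finType := (bool * 'I_r.+1 * 'I_(K ^ r).+1)%type.

Definition shifts (K r D : nat) : finType := {ffun node K r -> 'I_D.+1}.

Definition node_shift (K r D : nat) (s : shifts K r D) (b : bool) (j p : nat) : nat :=
  s (b, inord j, inord p).

Lemma node_shift_digit (K r D : nat) (s : shifts K r D) b j p d :
  d < K -> d + node_shift s b j p < K + D.
Proof. by move=> dK; rewrite -addSn leq_add // -ltnS ltn_ord. Qed.

(** * Probability that matched nodes are both queried *)

Section Collisions.
Variables (R : realType) (n r K D : nat) (side : 'I_n -> bool) (addr : 'I_n -> nat).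
Hypotheses (K0 : 0 < K) (addr_lt : forall i, addr i < K ^ r).
Implicit Types (s : shifts K r D) (i u w : 'I_n) (Q : {set 'I_n}).

Definition anc (j : nat) (i : 'I_n) : nat := addr i %/ K ^ (r - j).

Definition poslab s (j : nat) (i : 'I_n) : nat :=
  lab K (K + D) (node_shift s (side i)) j (anc j i).

Definition collide s (j : nat) (Q : {set 'I_n}) : bool :=
  [exists u in Q, exists w in Q,
    (side u != side w) && (poslab s j u == poslab s j w)].

Lemma anc_lt j i : anc j i < (K ^ r).+1.
Proof. by rewrite /anc (leq_ltn_trans (leq_div _ _)) // ltnW // ltnS addr_lt. Qed.

Definition anc_node (j : nat) (i : 'I_n) : node K r :=
  (side i, inord j, inord (anc j i)).

Lemma poslabS s j i : j < r ->
  poslab s j.+1 i =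
    poslab s j i * (K + D) + (anc j.+1 i %% K + s (anc_node j i)).
Proof. by move=> jr; rewrite /poslab /= /anc divnX_step. Qed.

Lemma poslab_divn s j i : j < r -> poslab s j.+1 i %/ (K + D) = poslab s j i.
Proof.
move=> jr; rewrite /poslab lab_divn //; last exact: node_shift_digit.
by rewrite /anc divnX_step.
Qed.

Lemma eq_poslab_off s s' j i (v : node K r) : j <= r ->
  (forall t, t != v -> s t = s' t) ->
  (forall k, k < j -> anc_node k i != v) ->
  poslab s j i = poslab s' j i.
Proof.
move=> jr ss' offv; apply: eq_lab => k kj; congr (nat_of_ord _).
have -> : anc j i %/ K ^ (j - k) = anc k i.
  rewrite /anc -divnMA -expnD; congr (_ %/ _ ^ _); lia.
exact/ss'/offv.
Qed.

Lemma anc_node_inj j k u w : j <= r -> k <= r ->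
  anc_node j u = anc_node k w -> [/\ side u = side w, j = k & anc j u = anc k w].
Proof.
move=> jr kr [-> /(congr1 val)/= ejk /(congr1 val)/= ep].
by split=> //; [move: ejk | move: ep]; rewrite !inordK ?anc_lt // ltnS.
Qed.

Variable f : shifts K r D -> {ffun 'I_n -> R}.
Hypothesis f_local : forall s s' i, poslab s r i = poslab s' r i -> f s i = f s' i.
Variable A : round_algo R n r.

(* A side of a matched pair of depth-[j] nodes that has not been queried still
   has a uniform shift, which one query pair pins down to a single value. *)
Lemma card_fresh_collision j u w : j < r -> side u != side w ->
  D.+1 * #|[set s : shifts K r D |
      [&& u \in queried A (f s) j.+1, w \in queried A (f s) j.+1 &
          [forall i in queried A (f s) j, anc_node j i != anc_node j w]] &&
      (poslab s j.+1 u == poslab s j.+1 w)]%SET| <=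
  #|[set s : shifts K r D | (u \in queried A (f s) j.+1) &&
       (w \in queried A (f s) j.+1)]%SET|.
Proof.
move=> jr uw; have jr' := ltnW jr.
pose E s := [&& u \in queried A (f s) j.+1, w \in queried A (f s) j.+1 &
          [forall i in queried A (f s) j, anc_node j i != anc_node j w]].
apply: (@leq_trans #|[set s | E s]%SET|); last first.
  apply: subset_leq_card; apply/fintype.subsetP => s; rewrite !inE.
  by case/and3P=> -> ->.
apply: (card_update_unique (v := anc_node j w)) => [s s' ss'|s s' ss'].
  move=> /and3P[uQ wQ /forall_inP fresh].
  (* Values read so far depend only on shifts along the paths to the queried leaves, and freshness
     keeps [anc_node j w] off these paths. *)
  have agree : {in queried A (f s) j, f s =1 f s'}.
    move=> i iQ; apply: f_local; apply: (eq_poslab_off (leqnn r) ss') => k kr.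
    apply/eqP => e.
    have [_ ekj _] := anc_node_inj (ltnW kr) jr' e; subst k.
    by have := fresh i iQ; rewrite e eqxx.
  rewrite /E -(eq_queriedS agree) -(eq_queried agree) uQ wQ /=.
  exact/forall_inP.
move=> /eqP Gs /eqP Gs'.
have eu : poslab s j.+1 u = poslab s' j.+1 u.
  apply: (eq_poslab_off jr ss') => k kj; apply/eqP => e.
  by have [e' _ _] := anc_node_inj (ltnW (leq_trans kj jr)) jr' e; rewrite e' eqxx in uw.
have ew : poslab s j w = poslab s' j w.
  apply: (eq_poslab_off jr' ss') => k kj; apply/eqP => e.
  have [_ ekj _] := anc_node_inj (ltnW (ltn_trans kj jr)) jr' e.
  by rewrite ekj ltnn in kj.
(* The label of [w] is its parent's label times [K + D], plus a digit, plus the free shift; equality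
   with the unchanged label of [u] pins that shift. *)
apply: val_inj => /=; move: eu; rewrite Gs Gs' !poslabS // ew.
by move=> /addnI/addnI.
Qed.

(** Equal labels at depth [j.+1] force equal labels of the parents. Were both parents already
    touched by [Q], they would collide at depth [j]; so one is fresh, and it is called the parent of
    [w]. *)
Lemma collide_new s j Q Q' : j < r -> ~~ collide s j Q -> collide s j.+1 Q' ->
  exists u w, [/\ u \in Q', w \in Q', side u != side w,
    poslab s j.+1 u == poslab s j.+1 w &
    [forall i in Q, anc_node j i != anc_node j w]].
Proof.
move=> jr nc /exists_inP[u uQ /exists_inP[w wQ /andP[uw euw]]].
have [fw|/forall_inPn[w' w'Q]] :=
  boolP [forall i in Q, anc_node j i != anc_node j w]; first by exists u, w.
rewrite negbK => /eqP ew.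
exists w, u; split; rewrite // 1?eq_sym //.
apply/forall_inP => u' u'Q; apply: contra nc => /eqP eu.
have [su _ au] := anc_node_inj (ltnW jr) (ltnW jr) eu.
have [sw _ aw] := anc_node_inj (ltnW jr) (ltnW jr) ew.
apply/exists_inP; exists u' => //; apply/exists_inP; exists w' => //.
rewrite su sw uw /= /poslab su sw au aw.
by move: euw => /eqP/(congr1 (divn^~ (K + D))); rewrite !poslab_divn // => /eqP.
Qed.

Variable q : nat.
Hypothesis card_q : forall g, num_queries A g <= q.

(** A union bound over all pairs of positions, then an exchange of sums: for each [s] at most
    [q ^ 2] pairs are actually queried. *)
Lemma card_collide_step j : j < r ->
  D.+1 * #|[set s : shifts K r D | ~~ collide s j (queried A (f s) j) &&
            collide s j.+1 (queried A (f s) j.+1)]%SET| <= q ^ 2 * #|shifts K r D|.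
Proof.
move=> jr; set B := [set s | _]%SET.
pose EG (p : 'I_n * 'I_n) := [set s : shifts K r D |
      [&& p.1 \in queried A (f s) j.+1, p.2 \in queried A (f s) j.+1 &
          [forall i in queried A (f s) j, anc_node j i != anc_node j p.2]] &&
      (poslab s j.+1 p.1 == poslab s j.+1 p.2)]%SET.
have le1 : #|B| <= \sum_(p | side p.1 != side p.2) #|EG p|.
  apply: (@leq_trans #|\bigcup_(p | side p.1 != side p.2) EG p|); last first.
    elim/big_ind2: _ => [|a b c d ab cd|//]; first by rewrite cards0.
    by rewrite (leq_trans (leq_card_setU _ _)) // leq_add.
  apply: subset_leq_card.
  apply/fintype.subsetP => s; rewrite inE => /andP[nc /(collide_new jr nc)].
  move=> [u [w [uQ wQ uw e fresh]]]; apply/bigcupP; exists (u, w) => //.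
  by rewrite inE /= uQ wQ fresh e.
apply: (leq_trans (leq_mul (leqnn _) le1)); rewrite big_distrr /=.
apply: (@leq_trans (\sum_(p : 'I_n * 'I_n) \sum_(s : shifts K r D)
   ((p.1 \in queried A (f s) j.+1) && (p.2 \in queried A (f s) j.+1)))).
  rewrite big_mkcond /=; apply: leq_sum => -[u w] _ /=; case: ifP => // uw.
  apply: leq_trans (card_fresh_collision jr uw) _.
  by rewrite -sum1dep_card big_mkcond.
rewrite exchange_big /=.
have -> : q ^ 2 * #|shifts K r D| = \sum_(s : shifts K r D) q ^ 2.
  by rewrite sum_nat_const mulnC.
apply: leq_sum => s _.
apply: (@leq_trans (#|queried A (f s) j.+1| ^ 2)); last first.
  by rewrite leq_exp2r // (leq_trans (card_queried _ _ _)).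
rewrite -mulnn -cardsX -sum1_card [leqRHS]big_mkcond /=; apply: leq_sum => -[u w] _ /=.
by rewrite inE.
Qed.

Lemma card_collide j : j <= r ->
  D.+1 * #|[set s : shifts K r D | collide s j (queried A (f s) j)]%SET| <=
  j * (q ^ 2 * #|shifts K r D|).
Proof.
elim: j => [|j IH] jr.
  rewrite mul0n leqn0 muln_eq0 /= cards_eq0; apply/eqP/setP => s.
  rewrite !inE queried0; apply/negbTE/exists_inPn => u; rewrite inE //.
rewrite [leqRHS]mulSn; apply: leq_trans (leq_add (card_collide_step jr) (IH (ltnW jr))).
rewrite -mulnDr leq_mul2l; apply/orP; right.
apply: leq_trans (leq_card_setU _ _); apply: subset_leq_card.
apply/fintype.subsetP => s; rewrite !inE => ->.
by case: collide.
Qed.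

End Collisions.

(** * The free and far inputs, and their indistinguishability *)

Section HardInputs.
Variables (R : realType) (n r K D : nat).

Definition pad : nat := n - 3 * K ^ r.

Definition yside (i : 'I_n) : bool := pad + 2 * K ^ r <= i.

(* Padding positions get a junk leaf, which is harmless: their value ignores it. *)
Definition leaf (i : 'I_n) : nat :=
  if yside i then i - (pad + 2 * K ^ r) else (K ^ r).-1 - (i - pad) %/ 2.

(** Coins are indexed by labels, so that matched leaves of the two trees share one. *)
Definition coins : finType := {ffun 'I_((K + D) ^ r).+1 -> bool}.

Definition level (s : shifts K r D) (i : 'I_n) : nat := poslab yside leaf s r i.

(** Each label owns a block of six values. The coin selects its lower or upper half; within a half,
    left values sit at offsets 0 and 2, right values at offset 1. *)
Definition hard_val (b : bool) (s : shifts K r D) (c : coins) (i : 'I_n) : nat :=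
  if i < pad then 6 * (K + D) ^ r else
  6 * level s i + 3 * (c (inord (level s i)) (+) (b && yside i)) +
  (if yside i then 1 else 2 * ((i - pad) %% 2)).

(* The first [pad] positions carry a maximal value. The next [2 K^r] list the
   left leaves in decreasing order of label, two increasing values per leaf; the
   last [K^r] list the right leaves in increasing order. A right value lies
   strictly between the two left values of its label iff the coins agree. *)
Definition hard (b : bool) (s : shifts K r D) (c : coins) : {ffun 'I_n -> R} :=
  [ffun i => (hard_val b s c i)%:R%R].

Hypotheses (K0 : 0 < K) (Kn : 3 * K ^ r <= n).

Lemma leaf_lt i : leaf i < K ^ r.
Proof.
have M0 : 0 < K ^ r by rewrite expn_gt0 K0.
rewrite /leaf /yside /pad; have := ltn_ord i; case: ifP => _; lia.
Qed.

Lemma level_lt s i : level s i < (K + D) ^ r.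
Proof. by apply: lab_lt => // *; exact: node_shift_digit. Qed.

Lemma levelE s i : level s i = lab K (K + D) (node_shift s (yside i)) r (leaf i).
Proof. by rewrite /level /poslab /anc subnn expn0 divn1. Qed.

Lemma ltn_level s i j : yside i = yside j -> leaf i < leaf j -> level s i < level s j.
Proof.
move=> e ij; rewrite !levelE e; apply: ltn_lab => //; last exact: leaf_lt.
by move=> *; exact: node_shift_digit.
Qed.

(** The first entry of a pattern is not padding, whose value is maximal. The second is not on the
    right, where values increase. So the first two form the pair of one left leaf; a value between
    them needs the same label, but the flipped coin puts the right value in the other half of the
    block. *)
Lemma hard_free s c : free_132 (hard true s c).
Proof.
move=> [i [j [l [ij jl il lj]]]]; move: il lj; rewrite !ffunE !ltr_nat.
have M0 : 0 < K ^ r by rewrite expn_gt0 K0.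
have [[Li Lj] Ll] := (level_lt s i, level_lt s j, level_lt s l).
have [ip|ip] := ltnP i pad.
  rewrite /hard_val ip; case: ifP => _; first by rewrite ltnn.
  move: (c _ (+) _) => x; case: (yside l); case: x; lia.
have jp : (j < pad) = false by lia.
have lp : (l < pad) = false by lia.
have ip' : (i < pad) = false by lia.
rewrite /hard_val ip' jp lp /=.
have ymono (u w : 'I_n) : yside u -> u < w -> yside w /\ level s u < level s w.
  move=> yu uw; have yw : yside w by move: yu; rewrite /yside; lia.
  split=> //; apply: ltn_level; first by rewrite yu yw.
  by rewrite /leaf yu yw; move: yu; rewrite /yside; lia.
have [yj|yj] := boolP (yside j).
  have [yl lt] := ymono _ _ yj jl; rewrite yl /=.
  move: (c _ (+) _) (c _ (+) _) (c _ (+) _) => x y z.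
  by case: x; case: y; case: z; lia.
have yi : yside i = false by move: yj; rewrite /yside; lia.
rewrite yi !addbF.
have [lti|lei] := ltnP (leaf j) (leaf i).
  have lt : level s j < level s i by apply: ltn_level; rewrite ?yi ?(negbTE yj).
  move: (c _) (c _) (c _ (+) _) => x y z; case: (yside l);
  by case: x; case: y; case: z; lia.
have [eqd e0] : (i - pad) %/ 2 = (j - pad) %/ 2 /\ (i - pad) %% 2 = 0.
  by move: lei; rewrite /leaf yi (negbTE yj); move: yj; rewrite /yside; lia.
have el : level s i = level s j.
  by rewrite !levelE yi (negbTE yj); congr lab; rewrite /leaf yi (negbTE yj) eqd.
rewrite el e0 muln0.
have [yl|yl] := boolP (yside l).
  have [elj|] := eqVneq (level s l) (level s j).
    by rewrite elj /=; case: (c _) => /=; lia.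
  move=> ne /=; move: (c _) (c _ (+) _) => x y; case: x; case: y => /=; lia.
have lt : level s l < level s j.
  apply: ltn_level; first by rewrite (negbTE yl) (negbTE yj).
  rewrite /leaf (negbTE yl) (negbTE yj).
  by move: yl yj; rewrite /yside; lia.
move: (c _) (c _) => x y; case: x; case: y => /=; lia.
Qed.

(** Each label with all digits in [[D, K)] occurs on both sides and yields a pattern [x1], [x2],
    [y]. Different labels use disjoint triples, and each triple needs a change. *)
Lemma hard_far s c g : D < K -> free_132 g ->
  (K - D) ^ r <= #|[set i | hard false s c i != g i]%SET|.
Proof.
move=> DK gfree; set Diff := [set i | _]%SET.
have M0 : 0 < K ^ r by rewrite expn_gt0 K0.
pose W := (K + D) ^ r; pose t u := lab (K - D) (K + D) (fun _ _ => D) r u.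
have tW j p d : d < K - D -> d + (fun _ _ : nat => D) j p < K + D by lia.
have KD : 0 < K - D by lia.
pose T (u : 'I_((K - D) ^ r)) : 'I_W.+1 := inord (t u).
have Tinj : injective T.
  move=> u v /(congr1 val) /=; rewrite !inordK; last 2 first.
  - by rewrite ltnW // ltnS; exact: lab_lt.
  - by rewrite ltnW // ltnS; exact: lab_lt.
  move=> e; apply: val_inj => /=; move: e.
  case: (ltngtP u v) => // uv; have := ltn_lab KD tW (ltn_ord _) uv;
  by rewrite -/(t _) -/(t _) => h e; rewrite e ltnn in h.
(* It suffices that every label [t u] is the level of some changed position. *)
rewrite -[X in X <= _](card_ord ((K - D) ^ r)) -cardsT -(card_imset _ Tinj).
apply: leq_trans (leq_imset_card (fun i => inord (level s i) : 'I_W.+1) Diff).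
apply: subset_leq_card; apply/fintype.subsetP => z /imsetP[u _ ->{z}].
have shD b j p : node_shift s b j p <= D by rewrite -ltnS ltn_ord.
have [px pxM ex] := lab_onto DK (shD false) (ltn_ord u).
have [py pyM ey] := lab_onto DK (shD true) (ltn_ord u).
have padE : pad + 3 * K ^ r = n by rewrite /pad subnK.
have hx1 : pad + 2 * ((K ^ r).-1 - px) < n by lia.
have hx2 : pad + 2 * ((K ^ r).-1 - px) + 1 < n by lia.
have hy : pad + 2 * K ^ r + py < n by lia.
pose x1 := Ordinal hx1; pose x2 := Ordinal hx2; pose y := Ordinal hy.
have sx1 : yside x1 = false by rewrite /yside /=; lia.
have sx2 : yside x2 = false by rewrite /yside /=; lia.
have sy : yside y = true by rewrite /yside /=; lia.
have lx1 : level s x1 = t u.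
  by rewrite levelE sx1 /t -ex; congr lab; rewrite /leaf sx1 /=; lia.
have lx2 : level s x2 = t u.
  by rewrite levelE sx2 /t -ex; congr lab; rewrite /leaf sx2 /=; lia.
have ly : level s y = t u.
  by rewrite levelE sy /t -ey; congr lab; rewrite /leaf sy /=; lia.
have px1 : (x1 < pad) = false by rewrite /=; lia.
have px2 : (x2 < pad) = false by rewrite /=; lia.
have ppy : (y < pad) = false by rewrite /=; lia.
suff [x xD lx] : exists2 x, x \in Diff & level s x = t u.
  by apply/imsetP; exists x => //; rewrite lx.
have [d1|] := boolP (x1 \in Diff); first by exists x1.
have [d2|] := boolP (x2 \in Diff); first by exists x2.
have [dy|] := boolP (y \in Diff); first by exists y.
rewrite !inE !negbK => /eqP ey' /eqP e2 /eqP e1; case: gfree.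
exists x1, x2, y; split; rewrite /= -?e1 -?e2 -?ey' ?ffunE ?ltr_nat; [lia|lia|..].
  rewrite /hard_val px1 ppy lx1 ly sx1 sy /=.
  have -> : (pad + 2 * ((K ^ r).-1 - px) - pad) %% 2 = 0 by lia.
  lia.
rewrite /hard_val px2 ppy lx2 ly sx2 sy /=.
have -> : (pad + 2 * ((K ^ r).-1 - px) + 1 - pad) %% 2 = 1 by lia.
lia.
Qed.

Variable A : round_algo R n r.

(* Flipping the coins of the queried right labels turns a collision-free run on
   a free input into the same run on a far input. *)
Lemma card_accepts_swap s :
  #|[set c | ~~ collide yside leaf s r (queried A (hard true s c) r) &&
             accepts A (hard true s c)]%SET| <=
  #|[set c | accepts A (hard false s c)]%SET|.
Proof.
pose flip (c : coins) : coins := [ffun v => c v (+)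
  [exists w in queried A (hard true s c) r, yside w && (inord (level s w) == v)]].
have agree c : ~~ collide yside leaf s r (queried A (hard true s c) r) ->
    {in queried A (hard true s c) r, hard true s c =1 hard false s (flip c)}.
  move=> nc i iQ; rewrite !ffunE; congr (_%:R)%R; rewrite /hard_val.
  case: ifP => // _; congr (_ + 3 * nat_of_bool _ + _); rewrite ffunE /= addbF.
  congr (_ (+) _); symmetry; have [yi|yi] := boolP (yside i).
    by apply/exists_inP; exists i; rewrite ?yi ?eqxx.
  apply/negbTE/exists_inPn => w wQ; rewrite negb_and -implybE.
  apply/implyP => yw; apply: contra nc => /eqP/(congr1 val) /=.
  rewrite !inordK ?ltnS 1?ltnW ?level_lt // => e.
  apply/exists_inP; exists w => //; apply/exists_inP; exists i => //.
  by rewrite yw (negbTE yi) /=; apply/eqP.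
have flip_inj : {in [set c | ~~ collide yside leaf s r (queried A (hard true s c) r) &&
             accepts A (hard true s c)]%SET &, injective flip}.
  move=> c1 c2; rewrite !inE => /andP[n1 _] /andP[n2 _] e.
  (* Both runs coincide with the run on the common far input, so both coin vectors are flipped by
     the same mask. *)
  have eQ : queried A (hard true s c1) r = queried A (hard true s c2) r.
    by rewrite (eq_queried (agree _ n1)) (eq_queried (agree _ n2)) e.
  apply/ffunP => v; have /ffunP/(_ v) := e; rewrite !ffunE eQ.
  exact: addIb.
rewrite -(card_in_imset flip_inj); apply: subset_leq_card.
apply/fintype.subsetP => c' /imsetP[c]; rewrite !inE => /andP[nc acc] ->.
by rewrite -(eq_accepts (agree _ nc)).
Qed.

Variable q : nat.
Hypothesis card_q : forall g, num_queries A g <= q.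

(** For fixed shifts the coin swap handles collision-free runs; for fixed coins [card_collide]
    bounds the remaining ones. *)
Lemma sum_accepts_hard :
  D.+1 * \sum_(p : shifts K r D * coins) accepts A (hard true p.1 p.2) <=
  D.+1 * \sum_(p : shifts K r D * coins) accepts A (hard false p.1 p.2) +
  r * q ^ 2 * #|{: shifts K r D * coins}|.
Proof.
pose col s c := collide yside leaf s r (queried A (hard true s c) r).
have le1 : \sum_(p : shifts K r D * coins) accepts A (hard true p.1 p.2) <=
    \sum_(p : shifts K r D * coins) accepts A (hard false p.1 p.2) +
    \sum_(p : shifts K r D * coins) col p.1 p.2.
  apply: (@leq_trans (\sum_(p : shifts K r D * coins)
      (~~ col p.1 p.2 && accepts A (hard true p.1 p.2)) +
      \sum_(p : shifts K r D * coins) col p.1 p.2)).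
    rewrite -big_split /=; apply: leq_sum => p _.
    by case: (col _ _); case: (accepts _ _).
  rewrite leq_add2r.
  rewrite -(pair_bigA _ (fun s c => (~~ col s c && accepts A (hard true s c) : nat))).
  rewrite -(pair_bigA _ (fun s c => (accepts A (hard false s c) : nat))) /=.
  apply: leq_sum => s _; have := card_accepts_swap s.
  by rewrite -!sum1dep_card big_mkcond [leqRHS]big_mkcond.
apply: leq_trans (leq_mul (leqnn _) le1) _; rewrite mulnDr leq_add2l.
rewrite -(pair_bigA _ (fun s c => (col s c : nat))) /= exchange_big /= big_distrr /=.
have -> : r * q ^ 2 * #|{: shifts K r D * coins}| =
    \sum_(c : coins) r * (q ^ 2 * #|shifts K r D|).
  by rewrite sum_nat_const card_prod [RHS]mulnC !mulnA.
apply: leq_sum => c _.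
have loc (s s' : shifts K r D) i : poslab yside leaf s r i = poslab yside leaf s' r i ->
    hard true s c i = hard true s' c i.
  by move=> e; rewrite !ffunE /hard_val /level e.
have := card_collide K0 leaf_lt loc card_q (leqnn r).
by rewrite -sum1dep_card big_mkcond.
Qed.

End HardInputs.

(** * Averaging over the random seed *)

Local Open Scope ring_scope.

(** Integration over the seed transfers a bound for deterministic algorithms to randomized ones. *)
Lemma sum_probability_le (R : realType) (d : measure_display) (T : measurableType d)
    (P : probability T R) (I : finType) (a b : I -> T -> bool) (M : R) :
  0 <= M ->
  (forall i, measurable [set w | a i w]%classic) ->
  (forall i, measurable [set w | b i w]%classic) ->
  (forall w, (\sum_i a i w)%N%:R <= (\sum_i b i w)%N%:R + M) ->
  (\sum_i P [set w | a i w]%classic <= \sum_i P [set w | b i w]%classic + M%:E)%E.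
Proof.
move=> M0 ma mb le_ab.
have intE (c : I -> T -> bool) : (forall i, measurable [set w | c i w]%classic) ->
    (\int[P]_w ((\sum_i c i w)%N%:R)%:E = \sum_i P [set w | c i w]%classic)%E.
  move=> mc; transitivity (\int[P]_w (\sum_i (\1_[set w | c i w]%classic w)%:E))%E.
    apply: eq_integral => w _; rewrite sumEFin; congr (_%:E).
    rewrite natr_sum; apply: eq_bigr => i _; rewrite indicE; congr (nat_of_bool _)%:R.
    by apply/idP/idP => [h|/set_mem//]; apply/mem_set.
  rewrite ge0_integral_sum //; last first.
    by move=> i; apply/measurable_EFinP; exact: measurable_indic.
  by apply: eq_bigr => i _; rewrite integral_indic // setIT.
have mfun (c : I -> T -> bool) : (forall i, measurable [set w | c i w]%classic) ->
    measurable_fun setT (fun w => ((\sum_i c i w)%N%:R : R)%:E).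
  move=> mc; apply/measurable_EFinP.
  have -> : (fun w => (\sum_i c i w)%N%:R : R) =
      (fun w => \sum_(i <- index_enum I) \1_[set w | c i w]%classic w).
    apply: funext => w; rewrite natr_sum; apply: eq_bigr => i _.
    rewrite indicE; congr (nat_of_bool _)%:R.
    by apply/idP/idP => [h|/set_mem//]; apply/mem_set.
  by apply: measurable_sum => i; exact: measurable_indic.
have -> : M%:E = (\int[P]_w (cst M%:E w))%E.
  by rewrite integral_cst // [X in (_ * X)%E](@probability_setT _ _ _ P) mule1.
rewrite -!intE // -ge0_integralD //; last exact: mfun.
apply: ge0_le_integral => //.
- exact: mfun.
- by apply: emeasurable_funD => //; exact: mfun.
- by move=> w _; rewrite /= lee_fin.
Qed.

Lemma probability_negb_le (R : realType) (d : measure_display)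
    (T : measurableType d) (P : probability T R) (a : T -> bool) :
  measurable [set w | a w]%classic ->
  ((2 / 3)%:E <= P [set w | ~~ a w]%classic)%E ->
  (P [set w | a w]%classic <= (1 / 3)%:E)%E.
Proof.
move=> ma.
have -> : ([set w | ~~ a w] = ~` [set w | a w])%classic.
  by apply/seteqP; split => w /= /negP.
have [x Px] : exists x : R, P [set w | a w]%classic = x%:E.
  by exists (fine (P [set w | a w]%classic)); rewrite fineK ?fin_num_measure.
rewrite probability_setC // Px -[X in (_ <= X)%E]/((1 - x)%:E) !lee_fin; lra.
Qed.

(** Mean acceptance is at least 2/3 on the free inputs and at most 1/3 on the far ones, while the
    gap is at most [r * q ^ 2 / D.+1]. *)
Lemma test_round_bound (R : realType) (n r : nat) (eps : R)
    (d : measure_display) (T : measurableType d) (P : probability T R)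
    (A : T -> round_algo R n r) (q K D : nat) :
  is_two_sided_test eps P A -> makes_at_most A q ->
  (D < K)%N -> (3 * K ^ r <= n)%N -> eps * n%:R < ((K - D) ^ r)%:R ->
  (D.+1 <= 3 * (r * q ^ 2))%N.
Proof.
move=> testA qA DK Kn far; have K0 : (0 < K)%N by lia.
set m := #|{: shifts K r D * coins r K D}|.
have m0 : 0 < m%:R :> R.
  rewrite ltr0n; apply/card_gt0P.
  by exists ([ffun=> ord0], [ffun=> false]).
pose h b (p : shifts K r D * coins r K D) : {ffun 'I_n -> R} := hard R n b p.1 p.2.
pose M : R := (r * q ^ 2 * m)%N%:R / D.+1%:R.
have M0 : 0 <= M by rewrite divr_ge0.
have := @sum_probability_le R d T P _ (fun p w => accepts (A w) (h true p))
  (fun p w => accepts (A w) (h false p)) M M0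
  (fun p => test_event testA _) (fun p => test_event testA _).
have ptw w : (\sum_p accepts (A w) (h true p))%N%:R <=
      (\sum_p accepts (A w) (h false p))%N%:R + M.
  have D0 : 0 < D.+1%:R :> R by rewrite ltr0n.
  rewrite -(ler_pM2l D0) mulrDr /M [_ * (_ / _)]mulrCA divff ?gt_eqF // mulr1.
  rewrite -!natrM -natrD ler_nat.
  exact: (sum_accepts_hard D K0 Kn (qA w)).
move=> /(_ ptw) le_sum.
have lo : ((m%:R * (2 / 3))%:E <=
    \sum_p P [set w | accepts (A w) (h true p)]%classic)%E.
  have -> : (m%:R * (2 / 3))%:E =
      (\sum_(p : shifts K r D * coins r K D) (2 / 3)%:E)%E :> \bar R.
    by rewrite sumEFin sumr_const mulr_natl.
  by apply: lee_sum => p _; apply: (test_complete testA); exact: hard_free.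
have hi : (\sum_p P [set w | accepts (A w) (h false p)]%classic <=
    (m%:R * (1 / 3))%:E)%E.
  have -> : (m%:R * (1 / 3))%:E =
      (\sum_(p : shifts K r D * coins r K D) (1 / 3)%:E)%E :> \bar R.
    by rewrite sumEFin sumr_const mulr_natl.
  apply: lee_sum => p _.
  have pfar : far_from_132_free eps (h false p).
    move=> g gfree; apply: lt_le_trans far _; rewrite ler_nat.
    exact: hard_far.
  exact: probability_negb_le (test_event testA _) (test_sound testA pfar).
have : m%:R * (2 / 3) <= m%:R * (1 / 3) + M.
  rewrite -lee_fin EFinD; apply: (le_trans lo); apply: (le_trans le_sum).
  by apply: leeD.
rewrite -lerBlDl /M ler_pdivlMr ?ltr0n // -(ler_nat R) => le_m.
rewrite -(ler_pM2r m0); move: le_m; rewrite !natrM; lra.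
Qed.

(** One free and one far input suffice, built from trees of depth 1 without shifts, whatever the
    number of rounds. *)
Lemma test_needs_query (R : realType) (n r : nat) (eps : R)
    (d : measure_display) (T : measurableType d) (P : probability T R)
    (A : T -> round_algo R n r) :
  is_two_sided_test eps P A -> eps <= 1 / 12 -> (3 <= n)%N -> ~ makes_at_most A 0.
Proof.
move=> testA eps12 n3 q0.
pose K := (n %/ 3)%N; have K0 : (0 < K)%N by rewrite /K; lia.
have Kn : (3 * K ^ 1 <= n)%N by rewrite expn1 /K; lia.
pose s : shifts K 1 0 := [ffun=> ord0]; pose c : coins 1 K 0 := [ffun=> false].
have far : far_from_132_free eps (hard R n false s c).
  move=> g gfree; have := hard_far K0 Kn s c K0 gfree; rewrite subn0 expn1 => le_K.
  apply: (@lt_le_trans _ _ K%:R); last by rewrite ler_nat.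
  apply: (@le_lt_trans _ _ (1 / 12 * n%:R)).
    by apply: ler_wpM2r.
  have : n%:R <= (3 * K + 2)%N%:R :> R by rewrite ler_nat /K; lia.
  have : 1 <= K%:R :> R by rewrite ler1n.
  rewrite natrD natrM; lra.
have := test_complete testA (@hard_free R n 1 K 0 K0 Kn s c).
have -> : [set w | accepts (A w) (hard R n true s c)]%classic =
          [set w | accepts (A w) (hard R n false s c)]%classic.
  apply/seteqP; split => w /=; rewrite (@eq_accepts _ _ _ _ _ (hard R n false s c)) //;
  move=> i; have := leq_trans (card_queried (A w) (hard R n true s c) r) (q0 w _);
  by rewrite leqn0 cards_eq0 => /eqP ->; rewrite inE.
move=> lo; have := le_trans lo (probability_negb_le (test_event testA _)
  (test_sound testA far)).
by rewrite lee_fin; lra.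
Qed.

(** * Choice of the parameters *)

Lemma expn_root_bracket (n r : nat) : (0 < r)%N -> (3 <= n)%N ->
  exists K : nat, (3 * K ^ r <= n < 3 * K.+1 ^ r)%N.
Proof.
move=> r0 n3.
have ex : exists K, (3 * K ^ r <= n)%N by exists 1%N; rewrite exp1n.
have bd K : (3 * K ^ r <= n)%N -> (K <= n)%N.
  move=> h; have : (K <= K ^ r)%N.
    by case: K h => // K _; rewrite -{1}(expn1 K.+1) leq_pexp2l.
  lia.
case: (ex_maxnP ex bd) => K hK maxK; exists K; rewrite hK /= ltnNge.
by apply/negP => /maxK; rewrite ltnn.
Qed.

(** The constants and powers of [r] total at most [2 ^ (2 + 3 * r + 2 * r ^ 2)], and [q] has
    exponent [2 * r]; both exponents are below [2 ^ (r + 3)]. *)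
Lemma tower_bound (r q : nat) : (0 < r)%N -> (0 < q)%N ->
  (3 * (6 * (r ^ 2 * q ^ 2)) ^ r <= (2 * q) ^ (2 ^ (r + 3)))%N.
Proof.
move=> r0 q0.
have lt2 : (r <= 2 ^ r)%N by apply: ltnW; exact: ltn_expl.
have e1 : (3 * r + 2 * r ^ 2 + 2 <= 2 ^ (r + 3))%N.
  rewrite addnC expnD -mulnn; elim: r {r0 lt2} => // r.
  have : (r < 2 ^ r)%N by exact: ltn_expl.
  rewrite [(2 ^ r.+1)%N]expnS; nia.
have -> : ((6 * (r ^ 2 * q ^ 2)) ^ r = 6 ^ r * (r ^ (2 * r) * q ^ (2 * r)))%N.
  by rewrite expnMn [((_ ^ 2 * _ ^ 2) ^ _)%N]expnMn -!expnM.
rewrite expnMn !mulnA; apply: leq_mul; last by rewrite leq_pexp2l //; nia.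
apply: (@leq_trans (2 ^ 2 * 2 ^ (3 * r) * 2 ^ (2 * r ^ 2))%N); last first.
  by rewrite -!expnD leq_pexp2l //; nia.
apply: leq_mul; first by apply: leq_mul => //; rewrite expnM leq_exp2r.
apply: (@leq_trans ((2 ^ r) ^ (2 * r))%N); first by rewrite leq_exp2r // muln_gt0.
by rewrite -expnM leq_pexp2l //; nia.
Qed.

Unset Implicit Arguments.

Theorem theorem3p14 (R : realType) :
  exists eps0 : R, 0 < eps0 /\
  forall eps : R, 0 < eps -> eps <= eps0 ->
  forall C : R, 0 < C ->
  exists c : R, 0 < c /\
  exists N : nat, forall n r : nat, (N <= n)%N ->
    r%:R <= (ln (ln (n%:R : R))) `^ C ->
    forall (d : measure_display) (T : measurableType d) (P : probability T R)
      (A : T -> round_algo R n r) (q : nat),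
      is_two_sided_test eps P A ->
      makes_at_most A q ->
      c * n%:R `^ (((2 ^ (r + 3))%:R)^-1) <= q%:R.
Proof.
(* The 12 comes from [n < 3 * K.+1 ^ r <= 6 * K ^ r <= 12 * (K - D) ^ r], assembled at the end. *)
exists (1 / 12); split; first by rewrite divr_gt0.
move=> eps _ eps12 C _; exists (1 / 2); split; first by rewrite divr_gt0.
exists 3%N => n r n3 _ d T P A q testA qA.
have no0 := test_needs_query testA eps12 n3.
have [r0|r0] := posnP r.
  case: no0 => w f; rewrite leqn0; apply/eqP.
  have num0 r' (B : round_algo R n r') : r' = 0%N -> num_queries B f = 0%N.
    by case: B.
  exact: num0.
have [q0|q0] := posnP q; first by subst q.
rewrite leNgt; apply/negP => lt_q.
(* The constant 1/2 supplies the base [2 * q] of [tower_bound]. *)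
have small : ((2 * q) ^ (2 ^ (r + 3)) < n)%N.
  rewrite -(ltr_nat R) natrX.
  set e := (2 ^ (r + 3))%N in lt_q *.
  have e0 : (0 < e)%N by rewrite expn_gt0.
  have -> : n%:R = (n%:R `^ (e%:R^-1)) ^+ e :> R.
    by rewrite -powR_mulrn ?powR_ge0 // -powRrM mulVf ?powRr1 // pnatr_eq0 -lt0n.
  rewrite ltrXn2r -?lt0n ?ler0n //.
  by rewrite natrM; move: lt_q; lra.
have [K /andP[Kn nK]] := expn_root_bracket r0 n3.
have bigK : (6 * (r ^ 2 * q ^ 2) <= K)%N.
  rewrite leqNgt; apply/negP => ltK.
  have : (3 * K.+1 ^ r <= 3 * (6 * (r ^ 2 * q ^ 2)) ^ r)%N.
    by rewrite leq_mul2l /= leq_exp2r.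
  by have := tower_bound r0 q0; lia.
(* With this [D], [test_round_bound] would give [D.+1 <= D]. *)
pose D := (3 * (r * q ^ 2))%N.
have rq : (0 < r * q ^ 2)%N by rewrite muln_gt0 r0 expn_gt0 q0.
have rD : (2 * (r * D) <= K)%N.
  by apply: leq_trans bigK; rewrite /D -[(r ^ 2)%N]mulnn; lia.
have DK : (D < K)%N by nia.
have h1 := expn_half_sub rD.
have h2 : (K.+1 ^ r <= 2 * K ^ r)%N.
  have := @expn_half_sub K.+1 1 r; rewrite subn1 /=; apply; nia.
suff far : eps * n%:R < ((K - D) ^ r)%N%:R.
  by have := test_round_bound testA qA DK Kn far; rewrite /D ltnn.
have : (n < 12 * (K - D) ^ r)%N by lia.
rewrite -(ltr_nat R) natrM.
have : eps * n%:R <= 1 / 12 * n%:R by apply: ler_wpM2r.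
lra.
Qed.
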